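(* Let $\Gamma\in\{G,W,O\}$, let $[\Gamma,\mathbb{B}]$ be the corresponding invariant line ($\mathbb{B}=D,E,B$ for $\Gamma=G,W,O$ respectively), and assume $1<\nu_\Gamma\le 8$. Let $M$ be a state on the segment $(\mathcal{U},\mathbb{B}]$. Then there are two states $\mathfrak{S},\mathcal{F}$ on the segment $[\Gamma,\mathcal{U})$ such that for any state $U$ on the invariant line with $s_U\in(s_{\mathcal{F}},s_{\mathfrak{S}})$ there is an undercompressive shock (for the identity viscosity matrix) with left state $U$, right state $M$ and speed $\sigma(U;M)$. The state $\mathfrak{S}$ satisfies $$\sigma(\mathfrak{S};M)=\lambda_s(\mathfrak{S}).$$ For the state $\mathcal{F}$ there are two cases: (a) if $s_M\in(s_{\mathcal{U}},s_{\mathrm{Y}^\Gamma}]$, then $\sigma(\mathcal{F};M)=\lambda_f(M)$; (b) if $s_M\in(s_{\mathrm{Y}^\Gamma},1]$, then $\sigma(\mathcal{F};M)=\lambda_f(\mathcal{F})$.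
   Context: Model. Let $\mu_w,\mu_o,\mu_g>0$ be the viscosities of water, oil, gas. Saturations are $s_w,s_o,s_g\ge 0$ with $s_w+s_o+s_g=1$; the saturation triangle is $\Omega=\{(s_w,s_o): s_w,s_o\ge0,\ s_w+s_o\le1\}$, with vertices $W,O,G$ where $s_w=1$, $s_o=1$, $s_g=1$ respectively. The flux is $F=(f_w,f_o)$ with $f_i=(s_i^2/\mu_i)/(\sum_{j\in\{w,o,g\}}s_j^2/\mu_j)$, and the system is $U_t+F(U)_x=0$, $U=(s_w,s_o)^T$. Denote by $\lambda_s(U)\le\lambda_f(U)$ the (slow and fast) eigenvalues of $DF(U)$. The umbilic point, where $\lambda_s=\lambda_f$, is $\mathcal{U}$ with $(s_w,s_o,s_g)=(\mu_w,\mu_o,\mu_g)/(\mu_w+\mu_o+\mu_g)$. Invariant lines. For $\Gamma\in\{G,W,O\}$ let $\gamma$ be the corresponding phase ($g,w,o$) and $\alpha,\beta$ the other two phases. Put $\nu_\Gamma=(\mu_\alpha+\mu_\beta)/\mu_\gamma$. The invariant line $[\Gamma,\mathbb{B}]$ is the set of states with $s_\alpha/\mu_\alpha=s_\beta/\mu_\beta$; it is parametrized by the effective saturation $s=s_\alpha+s_\beta\in[0,1]$, with $s=0$ at the vertex $\Gamma$ and $s=1$ at the point $\mathbb{B}$ on the opposite edge ($\mathbb{B}$ is named $D,E,B$ for $\Gamma=G,W,O$). For a state $M$ on this line, $s_M$ denotes its effective saturation; $s_{\mathcal{U}}=\nu_\Gamma/(1+\nu_\Gamma)$. Intervals such as $(\mathcal{U},\mathbb{B}]$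 denote segments of the line. With $E(s)=s^2+\nu_\Gamma(1-s)^2$, the eigenvalues of $DF$ along the line are $\lambda_a(s)=2s/E(s)$ and $\lambda_b(s)=2\nu_\Gamma s(1-s)/E(s)^2$, and $\lambda_s=\min\{\lambda_a,\lambda_b\}$, $\lambda_f=\max\{\lambda_a,\lambda_b\}$. The Rankine-Hugoniot speed $\sigma(M;N)$ between two states of the line (i.e. $F(N)-F(M)=\sigma(N-M)$) is $\sigma(M;N)=\nu_\Gamma(s_M+s_N-2s_Ms_N)/(E(s_M)E(s_N))$. Undercompressive shock (identity viscosity matrix). An undercompressive shock from left state $U^-$ to right state $U^+$ with speed $\sigma$ is a discontinuity satisfying $F(U^+)-F(U^-)=\sigma(U^+-U^-)$, for which $\lambda_s(U^\pm)<\sigma<\lambda_f(U^\pm)$ (so that $U^-$, $U^+$ are saddles of the ODE below), and having a viscous profile, i.e. there is an orbit of $\dot U=F(U)-F(U^-)-\sigma(U-U^-)$ going from $U^-$ (as time $\to-\infty$) to $U^+$ (as time $\to+\infty$). Fast double contact states. On the invariant line, $\mathcal{Y}^\Gamma$ and $\mathrm{Y}^\Gamma$ are the states with $s_{\mathcal{Y}^\Gamma}\le s_{\mathcal{U}}\le s_{\mathrm{Y}^\Gamma}$ satisfying $\sigma(\mathcal{Y}^\Gamma;\mathrm{Y}^\Gamma)=\lambda_f(\mathcal{Y}^\Gamma)=\lambda_f(\mathrm{Y}^\Gamma)$, explicitly $s_{\mathcal{Y}^\Gamma}=\frac12\sqrt{\frac{2\nu_\Gamma}{\nu_\Gamma+1}}$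 and $s_{\mathrm{Y}^\Gamma}=\frac{\nu_\Gamma+\sqrt{2\nu_\Gamma(\nu_\Gamma+1)}}{2(\nu_\Gamma+2)}$. *)

(* Defs.v *)
From Stdlib Require Import Reals Lra.
From Coquelicot Require Import Coquelicot.
Open Scope R_scope.

Inductive phase := water | oil | gas.

(* A state is the pair (s_w, s_o); the gas saturation is 1 - s_w - s_o. *)
Definition state : Type := (R * R)%type.

Definition sat (p : phase) (U : state) : R :=
  match p with
  | water => fst U
  | oil => snd U
  | gas => 1 - fst U - snd U
  end.

Definition in_triangle (U : state) : Prop := forall p, 0 <= sat p U.

(* The mobilities never vanish simultaneously, since the saturations sum to 1,
   so the flux is smooth on the whole plane, beyond the triangle. *)
Definition mobility (mu : phase -> R) (p : phase) (U : state) : R :=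
  sat p U ^ 2 / mu p.

Definition frac (mu : phase -> R) (p : phase) (U : state) : R :=
  mobility mu p U /
    (mobility mu water U + mobility mu oil U + mobility mu gas U).

Definition flux (mu : phase -> R) (U : state) : R * R :=
  (frac mu water U, frac mu oil U).

Definition d_w (f : state -> R) (U : state) : R :=
  Derive (fun x => f (x, snd U)) (fst U).

Definition d_o (f : state -> R) (U : state) : R :=
  Derive (fun y => f (fst U, y)) (snd U).

Definition flux_eigenvalue (mu : phase -> R) (U : state) (l : R) : Prop :=
  exists v : R * R, v <> (0, 0) /\
    d_w (frac mu water) U * fst v + d_o (frac mu water) U * snd v = l * fst v /\
    d_w (frac mu oil) U * fst v + d_o (frac mu oil) U * snd v = l * snd v.

(* There are at most two eigenvalues; when there is a real one, the infimum and
   the supremum are attained and are the least and the greatest eigenvalue. *)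
Definition lambda_s (mu : phase -> R) (U : state) : R :=
  real (Glb_Rbar (flux_eigenvalue mu U)).

Definition lambda_f (mu : phase -> R) (U : state) : R :=
  real (Lub_Rbar (flux_eigenvalue mu U)).

Definition umbilic (mu : phase -> R) : state :=
  let m := mu water + mu oil + mu gas in (mu water / m, mu oil / m).

(* A vertex of the triangle is denoted by the phase which is pure there. *)
Definition other1 (g : phase) : phase :=
  match g with water => oil | oil => water | gas => water end.

Definition other2 (g : phase) : phase :=
  match g with water => gas | oil => gas | gas => oil end.

Definition nu (mu : phase -> R) (g : phase) : R :=
  (mu (other1 g) + mu (other2 g)) / mu g.

Definition on_invariant_line (mu : phase -> R) (g : phase) (U : state) : Prop :=
  in_triangle U /\
  sat (other1 g) U / mu (other1 g) = sat (other2 g) U / mu (other2 g).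

(* The effective saturation: 0 at the vertex, 1 on the opposite edge. *)
Definition eff (g : phase) (U : state) : R :=
  sat (other1 g) U + sat (other2 g) U.

Definition E (n s : R) : R := s ^ 2 + n * (1 - s) ^ 2.

(* The Rankine-Hugoniot speed between two states of an invariant line;
   see [rh_speed_rankine_hugoniot]. *)
Definition rh_speed (mu : phase -> R) (g : phase) (M N : state) : R :=
  let n := nu mu g in
  n * (eff g M + eff g N - 2 * eff g M * eff g N) /
    (E n (eff g M) * E n (eff g N)).

Definition rankine_hugoniot (mu : phase -> R) (Um Up : state) (sg : R) : Prop :=
  fst (flux mu Up) - fst (flux mu Um) = sg * (fst Up - fst Um) /\
  snd (flux mu Up) - snd (flux mu Um) = sg * (snd Up - snd Um).

Definition viscous_profile (mu : phase -> R) (Um Up : state) (sg : R) : Prop :=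
  exists u : R -> state,
    (forall t, in_triangle (u t)) /\
    (forall t, is_derive (fun x => fst (u x)) t
       (fst (flux mu (u t)) - fst (flux mu Um) - sg * (fst (u t) - fst Um))) /\
    (forall t, is_derive (fun x => snd (u x)) t
       (snd (flux mu (u t)) - snd (flux mu Um) - sg * (snd (u t) - snd Um))) /\
    is_lim (fun t => fst (u t)) m_infty (fst Um) /\
    is_lim (fun t => snd (u t)) m_infty (snd Um) /\
    is_lim (fun t => fst (u t)) p_infty (fst Up) /\
    is_lim (fun t => snd (u t)) p_infty (snd Up).

(* [Um <> Up] is what "discontinuity" means. *)
Definition undercompressive_shock
    (mu : phase -> R) (Um Up : state) (sg : R) : Prop :=
  in_triangle Um /\ in_triangle Up /\ Um <> Up /\
  rankine_hugoniot mu Um Up sg /\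
  lambda_s mu Um < sg < lambda_f mu Um /\
  lambda_s mu Up < sg < lambda_f mu Up /\
  viscous_profile mu Um Up sg.

(* Effective saturation of the right one of the two fast double contact states,
   those distinct states Y1, Y2 of the invariant line, on either side of the
   umbilic point, with rh_speed Y1 Y2 = lambda_f Y1 = lambda_f Y2. *)
Definition s_Y (mu : phase -> R) (g : phase) : R :=
  let n := nu mu g in (n + sqrt (2 * n * (n + 1))) / (2 * (n + 2)).

Lemma frac_line (mu : phase -> R) (g : phase) (U : state) :
  (forall p, 0 < mu p) -> on_invariant_line mu g U ->
  let m := mu (other1 g) + mu (other2 g) in
  let s := eff g U in
  sat (other1 g) U = mu (other1 g) / m * s /\
  sat (other2 g) U = mu (other2 g) / m * s /\
  frac mu (other1 g) U = mu (other1 g) / m * (s ^ 2 / E (nu mu g) s) /\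
  frac mu (other2 g) U = mu (other2 g) / m * (s ^ 2 / E (nu mu g) s).
Proof.
intros Hmu [_ HL] m s.
assert (Ha := Hmu (other1 g)). assert (Hb := Hmu (other2 g)).
assert (Hc := Hmu g).
assert (Hm : 0 < m) by (unfold m; lra).
assert (Hab : sat (other1 g) U * mu (other2 g) =
              sat (other2 g) U * mu (other1 g)).
{ apply (f_equal (fun x => x * mu (other1 g) * mu (other2 g))) in HL.
  field_simplify in HL; lra. }
assert (H1 : sat (other1 g) U = mu (other1 g) / m * s).
{ unfold s, eff, m in *. field_simplify_eq; lra. }
assert (H2 : sat (other2 g) U = mu (other2 g) / m * s).
{ unfold s, eff, m in *. field_simplify_eq; lra. }
assert (H3 : sat g U = 1 - s) by (unfold s, eff; destruct g; simpl; ring).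
assert (Hn : 0 < nu mu g) by (apply Rdiv_lt_0_compat; assumption).
assert (HE : 0 < E (nu mu g) s).
{ unfold E. assert (K := pow2_ge_0 s). assert (K' := pow2_ge_0 (1 - s)).
  destruct (Req_dec s 0) as [->|Hs]; [ring_simplify; lra|].
  assert (0 < s ^ 2) by (apply pow2_gt_0; exact Hs).
  assert (0 <= nu mu g * (1 - s) ^ 2) by (apply Rmult_le_pos; lra).
  lra. }
assert (HD : mobility mu water U + mobility mu oil U + mobility mu gas U =
             E (nu mu g) s / m).
{ transitivity (mobility mu (other1 g) U + mobility mu (other2 g) U +
                mobility mu g U); [destruct g; simpl; ring|].
  unfold mobility, E, nu. rewrite H1, H2, H3. fold m. unfold m in *.
  field. lra. }
repeat split; try assumption; unfold frac; rewrite HD; unfold mobility;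
  [rewrite H1 | rewrite H2]; field; lra.
Qed.

Lemma rh_speed_rankine_hugoniot (mu : phase -> R) (g : phase) (M N : state) :
  (forall p, 0 < mu p) ->
  on_invariant_line mu g M -> on_invariant_line mu g N ->
  rankine_hugoniot mu M N (rh_speed mu g M N).
Proof.
intros Hmu HM HN.
destruct (frac_line mu g M Hmu HM) as (M1 & M2 & FM1 & FM2).
destruct (frac_line mu g N Hmu HN) as (N1 & N2 & FN1 & FN2).
assert (Hm : 0 < mu (other1 g) + mu (other2 g)).
{ assert (Ha := Hmu (other1 g)). assert (Hb := Hmu (other2 g)). lra. }
assert (Hn : 0 < nu mu g) by (apply Rdiv_lt_0_compat; auto).
assert (HE : forall s, E (nu mu g) s <> 0).
{ intros s. unfold E. apply Rgt_not_eq.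
  destruct (Req_dec s 0) as [->|Hs]; [ring_simplify; lra|].
  assert (0 < s ^ 2) by (apply pow2_gt_0; exact Hs).
  assert (0 <= nu mu g * (1 - s) ^ 2)
    by (apply Rmult_le_pos; [lra | apply pow2_ge_0]).
  lra. }
assert (Hone : forall V, frac mu gas V = 1 - frac mu water V - frac mu oil V).
{ intros V. unfold frac. field.
  assert (P : forall p, 0 <= mobility mu p V).
  { intro p. apply Rmult_le_pos; [apply pow2_ge_0|].
    left. apply Rinv_0_lt_compat, Hmu. }
  assert (Q : forall p, sat p V <> 0 -> 0 < mobility mu p V).
  { intros p Hp. apply Rdiv_lt_0_compat; [apply pow2_gt_0; exact Hp | auto]. }
  assert (Pw := P water). assert (Po := P oil). assert (Pg := P gas).
  destruct (Req_dec (sat water V) 0) as [Zw|Zw];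
    [|assert (T := Q _ Zw); lra].
  destruct (Req_dec (sat oil V) 0) as [Zo|Zo];
    [|assert (T := Q _ Zo); lra].
  assert (Zg : sat gas V <> 0) by (simpl in *; lra).
  assert (T := Q _ Zg). lra. }
assert (key : forall s t, t ^ 2 / E (nu mu g) t - s ^ 2 / E (nu mu g) s =
  nu mu g * (s + t - 2 * s * t) / (E (nu mu g) s * E (nu mu g) t) * (t - s)).
{ intros s t. assert (Hs := HE s). assert (Ht := HE t).
  field_simplify_eq; [|split; assumption]. unfold E. ring. }
specialize (key (eff g M) (eff g N)).
fold (rh_speed mu g M N) in key.
assert (D1 : frac mu (other1 g) N - frac mu (other1 g) M =
             rh_speed mu g M N * (sat (other1 g) N - sat (other1 g) M)).
{ rewrite FM1, FN1, M1, N1, <- !Rmult_minus_distr_l, key. unfold rh_speed. ring. }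
assert (D2 : frac mu (other2 g) N - frac mu (other2 g) M =
             rh_speed mu g M N * (sat (other2 g) N - sat (other2 g) M)).
{ rewrite FM2, FN2, M2, N2, <- !Rmult_minus_distr_l, key. unfold rh_speed. ring. }
clear - D1 D2 Hone.
unfold rankine_hugoniot, flux. cbn [fst snd].
destruct g; cbn [other1 other2 sat] in *; rewrite ?Hone in *; lra.
Qed.

(* Main.v *)
Require Import Defs.
From Stdlib Require Import Reals Lra Psatz.
From Coquelicot Require Import Coquelicot.
Open Scope R_scope.

(** Write [n] for [nu mu g], [u] and [m] for the effective saturations of the
    left state and of [M].  Along the invariant line the flux is again a point
    of the line, with effective saturation [s ^ 2 / E n s] ([flux_line_state]),
    so that the line is invariant under the profile equation, which becomes a
    scalar equation there.  The eigenvalues of the Jacobian are [lam_a]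
    (transverse to the line) and [lam_b], the derivative of [s ^ 2 / E n s]
    ([flux_eigenvalue_line]); they cross at the umbilic point, where
    [(1 + n) * s = n], with [lam_b] the faster one on the side of the vertex.

    The saddle conditions at both ends are therefore four inequalities between
    [speed n u m] and the values of [lam_a] and [lam_b] at [u] and at [m].
    After clearing denominators and the common factor [m - u], each one is the
    positivity of a polynomial of degree at most two in [u]:
    - [lam_a n u < speed n u m] is linear; it holds for [u] below
      [slow_root n m], which is the saturation of the slow threshold;
    - [speed n u m < lam_b n u] is [0 < left_gap n u m], a condition monotone
      in [u] that holds above [left_root n m];
    - [lam_b n m < speed n u m] follows from the previous one
      ([left_gap_swap]);
    - [speed n u m < lam_a n m] is [0 < right_gap n u m], a convex quadratic
      whose discriminant changes sign exactly when [m] crosses [s_Y mu g].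
    If [m <= s_Y mu g], the larger root of [right_gap] is at or above the root
    of [left_gap] and is the fast threshold, whence the contact with [lambda_f]
    at [M].  If [m > s_Y mu g], the last condition is void and the root of
    [left_gap] is the fast threshold, whence the contact at the left state.
    In both cases the fast threshold is below the slow one, which is below the
    umbilic point ([fast_threshold], [slow_root_range]).

    The profile lies on the line.  The scalar vector field is
    [(s - u) * (m - s)] times a positive function, because its remaining factor
    is affine and increasing in [s], with value [left_gap n u m] at [s = u]
    ([line_profile]).  Such a field has a heteroclinic orbit from [u] to [m]
    ([heteroclinic]). *)

(** * Shock speeds and characteristic speeds on an invariant line *)

Lemma pow2_lt_inv (x y : R) : 0 < y -> x ^ 2 < y ^ 2 -> x < y.
Proof. intros; nra. Qed.

Lemma pow2_le_inv (x y : R) : 0 <= y -> x ^ 2 <= y ^ 2 -> x <= y.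
Proof. intros; nra. Qed.

Lemma E_pos (n s : R) : 0 < n -> 0 < E n s.
Proof.
intros Hn. unfold E.
destruct (Req_dec s 0) as [->|Hs]; [nra|].
assert (0 < s ^ 2) by (apply pow2_gt_0; exact Hs).
assert (0 <= (1 - s) ^ 2) by apply pow2_ge_0. nra.
Qed.

Definition speed (n u m : R) : R :=
  n * (u + m - 2 * u * m) / (E n u * E n m).
(** The eigenvalues of the Jacobian of the flux at effective saturation [s]:
    [lam_a] for a direction transverse to the line, [lam_b] for the direction
    of the line; see [flux_eigenvalue_line]. *)
Definition lam_a (n s : R) : R := 2 * s / E n s.
Definition lam_b (n s : R) : R := 2 * n * s * (1 - s) / E n s ^ 2.

(** Up to a positive factor, [left_gap], [right_gap] and [slow_gap] are the
    differences [lam_b n u - speed n u m], [lam_a n m - speed n u m] and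
    [speed n u m - lam_a n u]; they vanish when the shock is characteristic. *)
Definition left_gap (n u m : R) : R :=
  (1 + n) * (1 - 2 * m) * u ^ 2 + 2 * (1 + n) * m * u - n.
Definition right_gap (n u m : R) : R :=
  2 * m * (1 + n) * u ^ 2 - n * (1 + 2 * m) * u + n * m.
Definition slow_gap (n u m : R) : R :=
  n * m - u * (2 * (1 + n) * m ^ 2 + n - 2 * n * m).

Lemma lam_b_minus_speed (n u m : R) : 0 < n ->
  lam_b n u - speed n u m = n * (m - u) * left_gap n u m / (E n u ^ 2 * E n m).
Proof.
intros Hn. assert (Hu := E_pos n u Hn). assert (Hm := E_pos n m Hn).
unfold lam_b, speed, left_gap. field_simplify_eq; [|lra]. unfold E; ring.
Qed.

Lemma speed_sym (n u m : R) : speed n u m = speed n m u.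
Proof. unfold speed, Rdiv. f_equal; [ring|f_equal; ring]. Qed.

Lemma lam_a_minus_speed_right (n u m : R) : 0 < n ->
  lam_a n m - speed n u m = right_gap n u m / (E n u * E n m).
Proof.
intros Hn. assert (Hu := E_pos n u Hn). assert (Hm := E_pos n m Hn).
unfold lam_a, speed, right_gap. field_simplify_eq; [|lra]. unfold E; ring.
Qed.

Lemma speed_minus_lam_a_left (n u m : R) : 0 < n ->
  speed n u m - lam_a n u = slow_gap n u m / (E n u * E n m).
Proof.
intros Hn. assert (Hu := E_pos n u Hn). assert (Hm := E_pos n m Hn).
unfold lam_a, speed, slow_gap. field_simplify_eq; [|lra]. unfold E; ring.
Qed.

(** The two eigenvalues cross at the umbilic point only, apart from the vertex
    [s = 0] where both vanish. *)
Lemma lam_b_minus_lam_a (n s : R) : 0 < n ->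
  lam_b n s - lam_a n s = 2 * s ^ 2 * (n - (1 + n) * s) / E n s ^ 2.
Proof.
intros Hn. assert (Hu := E_pos n s Hn).
unfold lam_a, lam_b. field_simplify_eq; [|lra]. unfold E; ring.
Qed.

(** Exchanging the two states turns the contact condition at the left state
    into the one at the right state, so the sign of this difference makes the
    right condition a consequence of the left one. *)
Lemma left_gap_swap (n u m : R) :
  left_gap n m u - left_gap n u m = (1 + n) * (m - u) * (m * (1 - u) + u * (1 - m)).
Proof. unfold left_gap; ring. Qed.

Lemma left_gap_increasing (n u v m : R) :
  0 < n -> 1 / 2 < m <= 1 -> 0 <= u < v -> v < 1 ->
  left_gap n u m < left_gap n v m.
Proof.
intros Hn Hm Hu Hv.
assert (H : left_gap n v m - left_gap n u m =
  (1 + n) * (v - u) * (2 * m - (2 * m - 1) * (u + v))) by (unfold left_gap; ring).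
assert (0 < 2 * m - (2 * m - 1) * (u + v)) by nra.
assert (0 < (1 + n) * (v - u)) by nra.
assert (0 < (1 + n) * (v - u) * (2 * m - (2 * m - 1) * (u + v)))
  by (apply Rmult_lt_0_compat; lra).
lra.
Qed.

Lemma speed_lt_lam_b_left (n u m : R) : 0 < n -> u < m -> 0 < left_gap n u m ->
  speed n u m < lam_b n u.
Proof.
intros Hn Hum HR. assert (H := lam_b_minus_speed n u m Hn).
assert (Hu := E_pos n u Hn). assert (Hm := E_pos n m Hn).
assert (0 < n * (m - u) * left_gap n u m / (E n u ^ 2 * E n m)).
{ apply Rdiv_lt_0_compat; [|apply Rmult_lt_0_compat; [apply pow_lt|]; assumption].
  repeat apply Rmult_lt_0_compat; lra. }
lra.
Qed.

Lemma lam_b_lt_speed_right (n u m : R) :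
  0 < n -> 0 <= u < m -> m <= 1 -> 0 <= left_gap n u m ->
  lam_b n m < speed n u m.
Proof.
intros Hn Hum Hm1 HR. assert (H := lam_b_minus_speed n m u Hn).
rewrite <- speed_sym in H.
assert (Hu := E_pos n u Hn). assert (Hm := E_pos n m Hn).
assert (HR' : 0 < left_gap n m u).
{ assert (K := left_gap_swap n u m).
  assert (0 < (1 + n) * (m - u) * (m * (1 - u) + u * (1 - m))).
  { repeat apply Rmult_lt_0_compat; try lra.
    assert (0 < m * (1 - u)) by (apply Rmult_lt_0_compat; lra).
    assert (0 <= u * (1 - m)) by (apply Rmult_le_pos; lra). lra. }
  lra. }
assert (0 < n * (m - u) * left_gap n m u / (E n m ^ 2 * E n u)).
{ apply Rdiv_lt_0_compat; [|apply Rmult_lt_0_compat; [apply pow_lt|]; assumption].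
  repeat apply Rmult_lt_0_compat; lra. }
replace (n * (u - m)) with (- (n * (m - u))) in H by ring.
unfold Rdiv in *. lra.
Qed.

Lemma lam_order_left (n s : R) : 0 < n -> (1 + n) * s <= n -> lam_a n s <= lam_b n s.
Proof.
intros Hn Hs. assert (H := lam_b_minus_lam_a n s Hn).
assert (HE := E_pos n s Hn).
assert (0 <= 2 * s ^ 2 * (n - (1 + n) * s) / E n s ^ 2).
{ apply Rdiv_le_0_compat; [|apply pow_lt, HE].
  assert (K := pow2_ge_0 s). apply Rmult_le_pos; lra. }
lra.
Qed.

Lemma lam_order_right (n s : R) : 0 < n -> n <= (1 + n) * s -> lam_b n s <= lam_a n s.
Proof.
intros Hn Hs. assert (H := lam_b_minus_lam_a n s Hn).
assert (HE := E_pos n s Hn).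
assert (0 <= 2 * s ^ 2 * ((1 + n) * s - n) / E n s ^ 2).
{ apply Rdiv_le_0_compat; [|apply pow_lt, HE].
  assert (K := pow2_ge_0 s). apply Rmult_le_pos; lra. }
replace (n - (1 + n) * s) with (- ((1 + n) * s - n)) in H by ring.
unfold Rdiv in *. lra.
Qed.

(** * Threshold saturations *)

(** The zero of the affine function [slow_gap n _ m]. *)
Definition slow_root (n m : R) : R :=
  n * m / (2 * (1 + n) * m ^ 2 + n - 2 * n * m).

Lemma slow_root_den (n m : R) : 0 < n -> 0 < m ->
  0 < 2 * (1 + n) * m ^ 2 + n - 2 * n * m.
Proof.
intros Hn Hm.
replace (2 * (1 + n) * m ^ 2 + n - 2 * n * m)
  with (2 * m ^ 2 + n * ((1 - m) ^ 2 + m ^ 2)) by ring.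
assert (0 < m ^ 2) by (apply pow2_gt_0; lra).
assert (0 <= (1 - m) ^ 2) by apply pow2_ge_0.
assert (0 < n * ((1 - m) ^ 2 + m ^ 2)) by (apply Rmult_lt_0_compat; lra).
lra.
Qed.

Lemma slow_gap_factor (n u m : R) : 0 < n -> 0 < m ->
  slow_gap n u m =
  (slow_root n m - u) * (2 * (1 + n) * m ^ 2 + n - 2 * n * m).
Proof.
intros Hn Hm. assert (H := slow_root_den n m Hn Hm).
unfold slow_gap, slow_root. field. lra.
Qed.

Lemma umbilic_gt_half (n m : R) : 1 < n -> n < (1 + n) * m -> 1 / 2 < m.
Proof. intros; nra. Qed.

(** The inequality [(1 + n) * slow_root n m < n] amounts to
    [0 < (2 * m - 1) * ((1 + n) * m - n)]; as the umbilic saturation exceeds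
    one half for [1 < n], both factors are positive beyond the umbilic point. *)
Lemma slow_root_range (n m : R) :
  1 < n -> n < (1 + n) * m -> m <= 1 ->
  0 < slow_root n m /\ (1 + n) * slow_root n m < n.
Proof.
intros Hn Hs Hm. assert (Hh := umbilic_gt_half n m Hn Hs).
assert (H : 0 < 2 * (1 + n) * m ^ 2 + n - 2 * n * m)
  by (apply slow_root_den; lra).
unfold slow_root. split; [apply Rdiv_lt_0_compat; nra|].
apply Rmult_lt_reg_r with (1 := H).
replace ((1 + n) * (n * m / (2 * (1 + n) * m ^ 2 + n - 2 * n * m)) *
  (2 * (1 + n) * m ^ 2 + n - 2 * n * m)) with ((1 + n) * n * m) by (field; lra).
assert (0 < n * ((2 * m - 1) * ((1 + n) * m - n)))
  by (apply Rmult_lt_0_compat; [lra | apply Rmult_lt_0_compat; lra]).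
nra.
Qed.

(** The discriminant of [right_gap n _ m], divided by [n]. *)
Definition right_disc (n m : R) : R := n + 4 * n * m - 4 * (n + 2) * m ^ 2.

Lemma right_gap_square (n u m : R) :
  8 * m * (1 + n) * right_gap n u m =
  (4 * m * (1 + n) * u - n * (1 + 2 * m)) ^ 2 - n * right_disc n m.
Proof. unfold right_gap, right_disc; ring. Qed.

(** The number [sY] is the larger root of the quadratic [right_disc n]; the
    smaller one is negative. *)
Lemma right_disc_sign (n m : R) : 0 < n -> 1 / 2 < m ->
  let sY := (n + sqrt (2 * n * (n + 1))) / (2 * (n + 2)) in
  (m <= sY -> 0 <= right_disc n m) /\ (sY < m -> right_disc n m < 0).
Proof.
intros Hn Hm sY. set (r := sqrt (2 * n * (n + 1))) in *.
assert (Hr : 0 <= r) by apply sqrt_pos.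
assert (Hr2 : r * r = 2 * n * (n + 1)) by (apply sqrt_def; nra).
assert (Hid : (n + 2) * right_disc n m = r * r - (2 * (n + 2) * m - n) ^ 2)
  by (rewrite Hr2; unfold right_disc; ring).
assert (HsY : 2 * (n + 2) * sY - n = r) by (unfold sY; field; lra).
assert (Hp : 0 < 2 * (n + 2) * m - n) by nra.
split; intros H.
- assert (2 * (n + 2) * m - n <= r) by nra.
  assert (0 <= (n + 2) * right_disc n m) by nra. nra.
- assert (r < 2 * (n + 2) * m - n) by nra.
  assert ((n + 2) * right_disc n m < 0) by nra. nra.
Qed.

(** The second clause selects the larger of the two roots. *)
Lemma right_root_exists (n m : R) :
  1 < n -> n < (1 + n) * m -> m <= 1 -> 0 <= right_disc n m ->
  exists F, right_gap n F m = 0 /\ n * (1 + 2 * m) <= 4 * m * (1 + n) * F.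
Proof.
intros Hn Hs Hm HD. assert (Hh := umbilic_gt_half n m Hn Hs).
assert (Hd : 0 <= n * right_disc n m) by (apply Rmult_le_pos; lra).
assert (Hq := sqrt_pos (n * right_disc n m)).
assert (Hq2 := sqrt_def _ Hd).
assert (HA : 0 < m * (1 + n)) by nra.
exists ((n * (1 + 2 * m) + sqrt (n * right_disc n m)) / (4 * m * (1 + n))).
set (F := _ / (4 * m * (1 + n))).
assert (HF : 4 * m * (1 + n) * F = n * (1 + 2 * m) + sqrt (n * right_disc n m))
  by (unfold F; field; lra).
split; [|lra].
apply Rmult_eq_reg_l with (8 * m * (1 + n)); [|nra].
rewrite right_gap_square, HF.
replace (n * (1 + 2 * m) + sqrt (n * right_disc n m) - n * (1 + 2 * m))
  with (sqrt (n * right_disc n m)) by ring.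
simpl. rewrite Rmult_1_r, Hq2. ring.
Qed.

(** With [w] the square root of the discriminant, the claims reduce to
    comparisons of [w] with polynomials in [m] and [n], and the difference of
    the squares factors into terms of known sign.  The claim
    [0 <= left_gap n F m] uses that [left_gap] is affine in [F] modulo
    [right_gap], so it compares [F] with an explicit rational function of [n]
    and [m]. *)
Lemma right_root_range (n F m : R) :
  1 < n -> n < (1 + n) * m -> m <= 1 -> 0 <= right_disc n m ->
  right_gap n F m = 0 -> n * (1 + 2 * m) <= 4 * m * (1 + n) * F ->
  0 < F /\ (1 + n) * F < n /\ F < slow_root n m /\ 0 <= left_gap n F m.
Proof.
intros Hn Hs Hm HD HK HF. assert (Hh := umbilic_gt_half n m Hn Hs).
assert (HA : 0 < m * (1 + n)) by nra.
assert (HF0 : 0 < F).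
{ apply Rmult_lt_reg_l with (m * (1 + n)); [exact HA|].
  assert (0 < n * (1 + 2 * m)) by (apply Rmult_lt_0_compat; lra). lra. }
assert (Hsq := right_gap_square n F m). rewrite HK, Rmult_0_r in Hsq.
set (w := 4 * m * (1 + n) * F - n * (1 + 2 * m)) in *.
assert (Hw : 0 <= w) by (unfold w; lra).
assert (Hw2 : w ^ 2 = n * right_disc n m) by lra.
assert (HE : 0 < E n m) by (apply E_pos; lra).
assert (HFm : (1 + n) * (F * m) < n).
{ assert (Hd : (n * (3 - 2 * m)) ^ 2 - w ^ 2 = 8 * n * E n m)
    by (rewrite Hw2; unfold right_disc, E; ring).
  assert (w < n * (3 - 2 * m)) by (apply pow2_lt_inv; nra).
  unfold w in *. lra. }
assert (HFs : (1 + n) * F < n).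
{ assert (Hd : (n * (2 * m - 1)) ^ 2 - w ^ 2 = 8 * (n * m * ((1 + n) * m - n)))
    by (rewrite Hw2; unfold right_disc; ring).
  assert (0 < n * m * ((1 + n) * m - n))
    by (repeat apply Rmult_lt_0_compat; lra).
  assert (w < n * (2 * m - 1)) by (apply pow2_lt_inv; nra).
  unfold w in *. apply Rmult_lt_reg_l with (4 * m); lra. }
split; [exact HF0|]. split; [exact HFs|]. split.
- assert (Hg : slow_gap n F m = 2 * (m - F) * (n - (1 + n) * (F * m)) - right_gap n F m)
    by (unfold slow_gap, right_gap; ring).
  rewrite HK, (slow_gap_factor n F m) in Hg by lra.
  assert (Hden := slow_root_den n m ltac:(lra) ltac:(lra)).
  assert (HFm' : F < m) by (apply Rmult_lt_reg_l with (1 + n); lra).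
  assert (0 < (m - F) * (n - (1 + n) * (F * m))) by (apply Rmult_lt_0_compat; lra).
  nra.
- set (D := right_disc n m) in *.
  assert (Hc : 0 < 4 * m ^ 2 + n) by nra.
  assert (Hd : ((4 * m ^ 2 + n) * w) ^ 2 - (n * (2 * m - 1) * D) ^ 2 =
    16 * (n * D * (m ^ 2 * (1 + n) * E n m))).
  { rewrite Rpow_mult_distr, Hw2. unfold D, right_disc, E. ring. }
  assert (0 <= n * D * (m ^ 2 * (1 + n) * E n m)).
  { apply Rmult_le_pos; [apply Rmult_le_pos; lra|].
    left. repeat apply Rmult_lt_0_compat; lra. }
  (* This compares F with n * m * (3 - 2 * m) / (4 * m ^ 2 + n), the zero of
     left_gap reduced modulo right_gap. *)
  assert (HW : n * (2 * m - 1) * D <= (4 * m ^ 2 + n) * w).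
  { apply pow2_le_inv; [apply Rmult_le_pos; lra | lra]. }
  assert (Hg : 8 * (m * (1 + n)) * m * left_gap n F m =
    4 * m * (1 + n) * (1 - 2 * m) * right_gap n F m +
    ((4 * m ^ 2 + n) * w - n * (2 * m - 1) * D))
    by (unfold left_gap, right_gap, w, D, right_disc; ring).
  rewrite HK in Hg.
  assert (0 < m * (1 + n) * m) by nra. nra.
Qed.

(** For [1 / 2 < m], the smaller root of [left_gap n _ m], in the rationalised
    form that keeps its positivity evident. *)
Definition left_root (n m : R) : R :=
  n / ((1 + n) * m + sqrt ((1 + n) * E n m)).

Lemma left_gap_left_root (n m : R) : 1 < n -> 0 < m ->
  left_gap n (left_root n m) m = 0.
Proof.
intros Hn Hm. assert (HE := E_pos n m ltac:(lra)).
assert (Hr := sqrt_pos ((1 + n) * E n m)).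
assert (Hr2 := sqrt_def ((1 + n) * E n m) ltac:(nra)).
unfold left_root, left_gap. set (r := sqrt ((1 + n) * E n m)) in *.
field_simplify_eq; [|nra].
replace (r ^ 2) with ((1 + n) * E n m) by lra. unfold E. ring.
Qed.

(** At [slow_root n m] the shock speed equals [lam_a], which is below [lam_b]
    before the umbilic point; hence [left_gap] is positive there, and by
    monotonicity its root comes earlier. *)
Lemma left_root_range (n m : R) :
  1 < n -> n < (1 + n) * m -> m <= 1 ->
  0 < left_root n m /\ (1 + n) * left_root n m < n /\
  left_root n m < slow_root n m.
Proof.
intros Hn Hs Hm. assert (Hh := umbilic_gt_half n m Hn Hs).
assert (HE := E_pos n m ltac:(lra)).
assert (Hr := sqrt_pos ((1 + n) * E n m)).
assert (Hp : n < (1 + n) * m + sqrt ((1 + n) * E n m)) by lra.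
assert (H0 : 0 < left_root n m) by (apply Rdiv_lt_0_compat; lra).
destruct (slow_root_range n m Hn Hs Hm) as [HS0 HS].
assert (HF1 : left_root n m < 1).
{ unfold left_root. apply Rlt_div_l; lra. }
assert (HRS : 0 < left_gap n (slow_root n m) m).
{ set (u := slow_root n m) in *.
  assert (Hg : n * (m - u) * left_gap n u m =
    2 * u ^ 2 * (n - (1 + n) * u) * E n m - slow_gap n u m * E n u)
    by (unfold left_gap, slow_gap, E; ring).
  rewrite slow_gap_factor in Hg by lra.
  assert (Hum : u < m) by (apply Rmult_lt_reg_l with (1 + n); lra).
  assert (0 < u ^ 2 * (n - (1 + n) * u) * E n m)
    by (apply Rmult_lt_0_compat; [apply Rmult_lt_0_compat;
      [apply pow2_gt_0|]|]; lra).
  assert (0 < n * (m - u)) by (apply Rmult_lt_0_compat; lra).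
  change (slow_root n m) with u in Hg.
  rewrite Rminus_diag in Hg. nra. }
assert (HF : left_root n m < slow_root n m).
{ apply Rnot_le_lt. intros Hc. assert (HR := left_gap_left_root n m Hn ltac:(lra)).
  destruct Hc as [Hc|Hc]; [|rewrite Hc in HRS; lra].
  assert (K := left_gap_increasing n (slow_root n m) (left_root n m) m
    ltac:(lra) ltac:(lra) ltac:(lra) HF1). lra. }
split; [exact H0|]. split; [|exact HF].
assert ((1 + n) * left_root n m < (1 + n) * slow_root n m)
  by (apply Rmult_lt_compat_l; lra).
lra.
Qed.

(** The fast threshold [F] is the larger root of [right_gap] or, when [right_gap]
    has no real root, the root of [left_gap]. *)
Lemma fast_threshold (n m : R) :
  1 < n -> n < (1 + n) * m -> m <= 1 ->
  let sY := (n + sqrt (2 * n * (n + 1))) / (2 * (n + 2)) in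
  exists F, 0 < F /\ (1 + n) * F < n /\ F < slow_root n m /\
    0 <= left_gap n F m /\
    (forall u, F < u -> 0 < right_gap n u m) /\
    (m <= sY -> right_gap n F m = 0) /\
    (sY < m -> left_gap n F m = 0).
Proof.
intros Hn Hs Hm sY. assert (Hh := umbilic_gt_half n m Hn Hs).
destruct (right_disc_sign n m ltac:(lra) Hh) as [Hle Hgt]. fold sY in Hle, Hgt.
assert (HA : 0 < m * (1 + n)) by (apply Rmult_lt_0_compat; lra).
destruct (Rle_dec m sY) as [H|H].
- specialize (Hle H).
  destruct (right_root_exists n m Hn Hs Hm Hle) as (F & HK & HF).
  destruct (right_root_range n F m Hn Hs Hm Hle HK HF) as (F0 & F1 & F2 & F3).
  exists F. split; [exact F0|]. split; [exact F1|]. split; [exact F2|].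
  split; [exact F3|]. split; [|split; [intros _; exact HK | intros; lra]].
  intros u Hu.
  assert (Sq := right_gap_square n u m). assert (Sq' := right_gap_square n F m).
  rewrite HK in Sq'.
  assert (0 < m * (1 + n) * (u - F)) by (apply Rmult_lt_0_compat; lra).
  apply Rmult_lt_reg_l with (8 * m * (1 + n)); [lra|]. nra.
- apply Rnot_le_lt in H. specialize (Hgt H).
  destruct (left_root_range n m Hn Hs Hm) as (F0 & F1 & F2).
  assert (F3 := left_gap_left_root n m Hn ltac:(lra)).
  exists (left_root n m). split; [exact F0|]. split; [exact F1|].
  split; [exact F2|]. split; [lra|]. split; [|split; [intros; lra | intros _; exact F3]].
  intros u _. assert (Sq := right_gap_square n u m).
  assert (K := pow2_ge_0 (4 * m * (1 + n) * u - n * (1 + 2 * m))).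
  assert (0 < n * - right_disc n m) by (apply Rmult_lt_0_compat; lra).
  apply Rmult_lt_reg_l with (8 * m * (1 + n)); lra.
Qed.

(** * Heteroclinic orbits of scalar equations *)

(** Since [Phi' >= c > 0], the function [Phi] is a bijection of the line whose
    inverse is Lipschitz with constant [/ c]; this turns the expansion of [Phi]
    at [psi t] into one of [psi] at [t].  Here [Phi] will be the time as a
    function of a parameter along an orbit. *)
Lemma inverse_flow (Phi phi : R -> R) (c : R) :
  0 < c -> (forall x, is_derive Phi x (phi x)) -> (forall x, c <= phi x) ->
  exists psi : R -> R,
    (forall t, is_derive psi t (/ phi (psi t))) /\
    is_lim psi m_infty m_infty /\ is_lim psi p_infty p_infty.
Proof.
intros Hc Hd Hphi.
assert (Hincr : forall a b, a <= b -> c * (b - a) <= Phi b - Phi a).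
{ intros a b Hab.
  destruct (MVT_gen Phi a b phi) as (x & Hx & ->).
  - intros x _; apply Hd.
  - intros x _. apply derivable_continuous_pt.
    exists (phi x). apply is_derive_Reals, Hd.
  - apply Rmult_le_compat_r; [lra | apply Hphi]. }
assert (Hcont : continuity Phi).
{ intros x. apply derivable_continuous_pt.
  exists (phi x). apply is_derive_Reals, Hd. }
assert (Hex : forall t, {x | Phi x = t}).
{ intros t. set (r := Rabs (t - Phi 0) / c).
  assert (Hr : 0 <= r) by (apply Rdiv_le_0_compat; [apply Rabs_pos | exact Hc]).
  assert (Hcr : c * r = Rabs (t - Phi 0)) by (unfold r; field; lra).
  assert (H1 := Hincr 0 r Hr). assert (H2 := Hincr (- r) 0 ltac:(lra)).
  assert (H3 := Rle_abs (t - Phi 0)).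
  assert (H4 := Rle_abs (- (t - Phi 0))). rewrite Rabs_Ropp in H4.
  destruct (IVT_gen Phi (- r) r t Hcont) as (x & _ & Hx).
  - rewrite Rmin_left, Rmax_right; lra.
  - exists x; exact Hx. }
set (psi := fun t => proj1_sig (Hex t)).
assert (Hpsi : forall t, Phi (psi t) = t)
  by (intros t; unfold psi; destruct (Hex t); assumption).
assert (Hlip : forall t t', c * Rabs (psi t' - psi t) <= Rabs (t' - t)).
{ intros t t'. rewrite <- (Hpsi t), <- (Hpsi t') at 2.
  destruct (Rle_dec (psi t) (psi t')) as [H|H].
  - assert (K := Hincr _ _ H). rewrite !Rabs_pos_eq; nra.
  - assert (K := Hincr (psi t') (psi t) ltac:(lra)).
    rewrite !Rabs_left1; nra. }
exists psi. split; [|split].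
- intros t. assert (Hp : 0 < phi (psi t)) by (specialize (Hphi (psi t)); lra).
  split; [apply is_linear_scal_l|].
  intros x Hx. apply (@is_filter_lim_locally_unique R_AbsRing R_NormedModule) in Hx. subst x.
  intros eps.
  destruct (Hd (psi t)) as [_ Hdom].
  specialize (Hdom (psi t) (fun P H => H)).
  (* The error of Phi is divided by phi (psi t) and measured against
     Rabs (psi t' - psi t) <= Rabs (t' - t) / c. *)
  assert (Heps : 0 < eps * c * phi (psi t))
    by (repeat apply Rmult_lt_0_compat; [apply cond_pos | |]; assumption).
  destruct (Hdom (mkposreal _ Heps)) as [d Hd'].
  assert (Hdc : 0 < c * d) by (apply Rmult_lt_0_compat; [assumption | apply cond_pos]).
  exists (mkposreal _ Hdc). intros t' Ht'.
  assert (Hy : ball (psi t) d (psi t')).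
  { change (Rabs (psi t' - psi t) < d).
    change (Rabs (t' - t) < c * d) in Ht'.
    apply Rmult_lt_reg_l with c; [exact Hc|]. eapply Rle_lt_trans; [apply Hlip | exact Ht']. }
  specialize (Hd' _ Hy). clear Hy Ht'.
  change (Rabs (Phi (psi t') - Phi (psi t) - (psi t' - psi t) * phi (psi t))
    <= eps * c * phi (psi t) * Rabs (psi t' - psi t)) in Hd'.
  change (Rabs (psi t' - psi t - (t' - t) * / phi (psi t)) <= eps * Rabs (t' - t)).
  rewrite !Hpsi in Hd'.
  replace (psi t' - psi t - (t' - t) * / phi (psi t)) with
    (- (t' - t - (psi t' - psi t) * phi (psi t)) / phi (psi t)) by (field; lra).
  unfold Rdiv. rewrite Rabs_mult, Rabs_Ropp, Rabs_inv, (Rabs_pos_eq (phi _)) by lra.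
  apply Rmult_le_reg_r with (phi (psi t)); [exact Hp|].
  rewrite Rmult_assoc, Rinv_l, Rmult_1_r by lra.
  eapply Rle_trans; [exact Hd'|].
  assert (K := Hlip t t'). assert (He := cond_pos eps).
  assert (0 < eps * phi (psi t)) by (apply Rmult_lt_0_compat; assumption).
  assert (eps * phi (psi t) * (c * Rabs (psi t' - psi t))
    <= eps * phi (psi t) * Rabs (t' - t)) by (apply Rmult_le_compat_l; lra).
  lra.
- apply is_lim_spec. intros B. exists (Phi B). intros t Ht.
  destruct (Rlt_dec (psi t) B) as [H|H]; [exact H|].
  assert (K := Hincr B (psi t) ltac:(lra)). rewrite Hpsi in K. nra.
- apply is_lim_spec. intros B. exists (Phi B). intros t Ht.
  destruct (Rlt_dec B (psi t)) as [H|H]; [exact H|].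
  assert (K := Hincr (psi t) B ltac:(lra)). rewrite Hpsi in K. nra.
Qed.

(** The orbit from [a] to [b] of the model field [(y - a) * (b - y) / (b - a)]. *)
Definition logistic (a b x : R) : R := b - (b - a) / (1 + exp x).

Lemma logistic_between (a b x : R) : a < b -> a < logistic a b x < b.
Proof.
intros H. assert (He := exp_pos x). unfold logistic.
assert (Hq : (b - a) / (1 + exp x) * (1 + exp x) = b - a) by (field; lra).
assert (0 < (b - a) / (1 + exp x)) by (apply Rdiv_lt_0_compat; lra).
nra.
Qed.

Lemma is_derive_logistic (a b x : R) : a < b ->
  is_derive (logistic a b) x
    ((logistic a b x - a) * (b - logistic a b x) / (b - a)).
Proof.
intros H. assert (He := exp_pos x). unfold logistic.
auto_derive; [lra|]. field. lra.
Qed.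

Lemma is_lim_logistic_m (a b : R) : is_lim (logistic a b) m_infty a.
Proof.
unfold logistic.
replace (Finite a) with (Finite (b - (b - a) * / (1 + 0))) by (f_equal; field).
apply is_lim_minus with (Finite b) (Finite ((b - a) * / (1 + 0)));
  [apply is_lim_const | | reflexivity].
apply (is_lim_scal_l (fun x => / (1 + exp x)) (b - a) m_infty (/ (1 + 0))).
apply (is_lim_inv (fun x => 1 + exp x) m_infty (Finite (1 + 0))).
- eapply is_lim_plus; [apply is_lim_const | apply is_lim_exp_m | reflexivity].
- intros K. injection K. lra.
Qed.

Lemma is_lim_logistic_p (a b : R) : is_lim (logistic a b) p_infty b.
Proof.
unfold logistic.
replace (Finite b) with (Finite (b - (b - a) * 0)) by (f_equal; ring).
apply is_lim_minus with (Finite b) (Finite ((b - a) * 0));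
  [apply is_lim_const | | reflexivity].
apply (is_lim_scal_l (fun x => / (1 + exp x)) (b - a) p_infty 0).
apply (is_lim_inv (fun x => 1 + exp x) p_infty p_infty); [|discriminate].
eapply is_lim_plus; [apply is_lim_const | apply is_lim_exp_p | reflexivity].
Qed.

(** The field has the same orbits as the logistic field, so its solution is the
    logistic one after a change of time.  The new time is the integral of
    [/ ((b - a) * k)] along the logistic orbit, an integrand bounded below
    because [k] is bounded on the compact segment. *)
Lemma heteroclinic (a b : R) (k : R -> R) :
  a < b -> (forall x, a <= x <= b -> continuous k x /\ 0 < k x) ->
  exists y : R -> R,
    (forall t, a <= y t <= b) /\
    (forall t, is_derive y t ((y t - a) * (b - y t) * k (y t))) /\
    is_lim y m_infty a /\ is_lim y p_infty b.
Proof.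
intros Hab Hk.
destruct (continuity_ab_maj k a b) as (xM & HxM & HxMab); [lra | |].
{ intros x Hx. apply continuity_pt_filterlim, Hk, Hx. }
assert (HM : 0 < k xM) by (apply Hk; exact HxMab).
set (L := logistic a b).
assert (HL : forall x, a < L x < b) by (intros x; apply logistic_between, Hab).
assert (HkL : forall x, 0 < k (L x))
  by (intros x; apply Hk; specialize (HL x); lra).
set (phi := fun x => / ((b - a) * k (L x))).
assert (Hphi : forall x, continuous phi x).
{ intros x. apply continuous_Rinv_comp.
  - apply (continuous_mult (fun _ => b - a) (fun x => k (L x)));
      [apply continuous_const|].
    apply (continuous_comp L k).
    + apply (@ex_derive_continuous R_AbsRing R_NormedModule).
      eexists. apply is_derive_logistic, Hab.
    + apply Hk. specialize (HL x). lra.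
  - specialize (HkL x). nra. }
destruct (inverse_flow (fun x => RInt phi 0 x) phi (/ ((b - a) * k xM)))
  as (psi & Hpsi & Hm & Hp).
- apply Rinv_0_lt_compat, Rmult_lt_0_compat; lra.
- intros x. apply is_derive_RInt with 0; [|apply Hphi].
  apply filter_forall. intros z. apply (@RInt_correct R_CompleteNormedModule),
    (@ex_RInt_continuous R_CompleteNormedModule).
  intros; apply Hphi.
- intros x. specialize (HkL x). assert (Hx := HL x).
  apply Rinv_le_contravar; [apply Rmult_lt_0_compat; lra|].
  apply Rmult_le_compat_l; [lra | apply HxM; lra].
- exists (fun t => L (psi t)). split; [|split; [|split]].
  + intros t. specialize (HL (psi t)). lra.
  + intros t.
    evar_last; [apply (is_derive_comp L psi);
      [apply is_derive_logistic, Hab | apply Hpsi]|].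
    unfold phi, scal; simpl; unfold mult; simpl. fold L.
    specialize (HkL (psi t)). field. lra.
  + apply is_lim_comp with m_infty; [apply is_lim_logistic_m | exact Hm |].
    exists 0; discriminate.
  + apply is_lim_comp with p_infty; [apply is_lim_logistic_p | exact Hp |].
    exists 0; discriminate.
Qed.

(** * The invariant line inside the saturation triangle *)

Definition vertex (g : phase) : R * R :=
  match g with water => (1, 0) | oil => (0, 1) | gas => (0, 0) end.

Definition direction (mu : phase -> R) (g : phase) : R * R :=
  let m := mu (other1 g) + mu (other2 g) in
  match g with
  | water => (-1, mu oil / m)
  | oil => (mu water / m, -1)
  | gas => (mu water / m, mu oil / m)
  end.

(** The point of effective saturation [s] on the line, as an affine function of
    [s] so that all three choices of the vertex are treated alike. *)
Definition line_state (mu : phase -> R) (g : phase) (s : R) : state :=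
  (fst (vertex g) + fst (direction mu g) * s,
   snd (vertex g) + snd (direction mu g) * s).

Lemma line_state_sat (mu : phase -> R) (g : phase) (s : R) :
  (forall p, 0 < mu p) ->
  let m := mu (other1 g) + mu (other2 g) in
  sat (other1 g) (line_state mu g s) = mu (other1 g) / m * s /\
  sat (other2 g) (line_state mu g s) = mu (other2 g) / m * s /\
  sat g (line_state mu g s) = 1 - s.
Proof.
intros Hmu m.
assert (H1 := Hmu (other1 g)). assert (H2 := Hmu (other2 g)).
unfold m, line_state; destruct g; cbn in *;
  repeat split; try ring; field; lra.
Qed.

Lemma eff_line_state (mu : phase -> R) (g : phase) (s : R) :
  (forall p, 0 < mu p) -> eff g (line_state mu g s) = s.
Proof.
intros Hmu. destruct (line_state_sat mu g s Hmu) as (H1 & H2 & _). unfold eff. rewrite H1, H2.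
assert (P1 := Hmu (other1 g)). assert (P2 := Hmu (other2 g)).
field. lra.
Qed.

Lemma line_state_on_line (mu : phase -> R) (g : phase) (s : R) :
  (forall p, 0 < mu p) -> 0 <= s <= 1 ->
  on_invariant_line mu g (line_state mu g s).
Proof.
intros Hmu Hs. destruct (line_state_sat mu g s Hmu) as (H1 & H2 & H3).
set (m := mu (other1 g) + mu (other2 g)) in *.
assert (P1 := Hmu (other1 g)). assert (P2 := Hmu (other2 g)).
assert (Hm : 0 < m) by (unfold m; lra).
split.
- assert (A : forall p, 0 <= mu p / m * s).
  { intros p. apply Rmult_le_pos; [|lra]. left. apply Rdiv_lt_0_compat; auto. }
  assert (A1 := A (other1 g)). assert (A2 := A (other2 g)).
  rewrite <- H1 in A1. rewrite <- H2 in A2.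
  assert (A3 : 0 <= sat g (line_state mu g s)) by lra.
  clear - A1 A2 A3. intros p. destruct g, p; assumption.
- rewrite H1, H2. field. lra.
Qed.

Lemma on_line_line_state (mu : phase -> R) (g : phase) (U : state) :
  (forall p, 0 < mu p) -> on_invariant_line mu g U ->
  U = line_state mu g (eff g U).
Proof.
intros Hmu HU. destruct (frac_line mu g U Hmu HU) as (A1 & A2 & _).
assert (A3 : sat g U = 1 - eff g U) by (unfold eff; destruct g; simpl; ring).
destruct (line_state_sat mu g (eff g U) Hmu) as (H1 & H2 & H3).
rewrite <- H1 in A1. rewrite <- H2 in A2. rewrite <- H3 in A3.
clear - A1 A2 A3. destruct U as [x y], (line_state mu g _) as [x' y'].
destruct g; cbn in *; f_equal; lra.
Qed.

Definition mobilities (mu : phase -> R) (U : state) : R :=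
  mobility mu water U + mobility mu oil U + mobility mu gas U.

Lemma mobilities_pos (mu : phase -> R) (U : state) :
  (forall p, 0 < mu p) -> 0 < mobilities mu U.
Proof.
intros Hmu.
assert (P : forall p, 0 <= mobility mu p U).
{ intro p. apply Rdiv_le_0_compat; [apply pow2_ge_0 | apply Hmu]. }
assert (Q : forall p, sat p U <> 0 -> 0 < mobility mu p U).
{ intros p Hp. apply Rdiv_lt_0_compat; [apply pow2_gt_0; exact Hp | auto]. }
assert (Pw := P water). assert (Po := P oil). assert (Pg := P gas).
unfold mobilities.
destruct (Req_dec (sat water U) 0) as [Zw|Zw]; [|specialize (Q _ Zw); lra].
destruct (Req_dec (sat oil U) 0) as [Zo|Zo]; [|specialize (Q _ Zo); lra].
assert (Zg : sat gas U <> 0) by (simpl in *; lra).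
specialize (Q _ Zg). lra.
Qed.

Lemma frac_sum (mu : phase -> R) (U : state) :
  (forall p, 0 < mu p) ->
  frac mu gas U = 1 - frac mu water U - frac mu oil U.
Proof.
intros Hmu. assert (HT := mobilities_pos mu U Hmu). unfold frac, mobilities in *. field. lra.
Qed.

Lemma flux_line_state (mu : phase -> R) (g : phase) (s : R) :
  (forall p, 0 < mu p) -> 0 <= s <= 1 ->
  flux mu (line_state mu g s) = line_state mu g (s ^ 2 / E (nu mu g) s).
Proof.
intros Hmu Hs.
destruct (frac_line mu g _ Hmu (line_state_on_line mu g s Hmu Hs))
  as (_ & _ & A1 & A2).
rewrite eff_line_state in A1, A2 by exact Hmu.
set (f := s ^ 2 / E (nu mu g) s) in *.
destruct (line_state_sat mu g f Hmu) as (H1 & H2 & H3).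
rewrite <- H1 in A1. rewrite <- H2 in A2.
assert (S := frac_sum mu (line_state mu g s) Hmu). unfold flux.
clear - A1 A2 S. destruct (line_state mu g f) as [x y].
destruct g; cbn in A1, A2; f_equal; lra.
Qed.

Lemma eff_umbilic (mu : phase -> R) (g : phase) :
  (forall p, 0 < mu p) -> (1 + nu mu g) * eff g (umbilic mu) = nu mu g.
Proof.
intros Hmu. assert (Pw := Hmu water). assert (Po := Hmu oil). assert (Pg := Hmu gas).
unfold eff, umbilic, nu; destruct g; cbn; field; lra.
Qed.

(** * Eigenvalues along the invariant line *)

(** For the converse, an eigenvector is a column of the adjugate of the matrix
    minus [l], or any vector when that adjugate is zero. *)
Lemma flux_eigenvalue_charpoly (mu : phase -> R) (U : state) (l a b c d : R) :
  d_w (frac mu water) U = a -> d_o (frac mu water) U = b ->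
  d_w (frac mu oil) U = c -> d_o (frac mu oil) U = d ->
  flux_eigenvalue mu U l <-> (a - l) * (d - l) - b * c = 0.
Proof.
intros Ha Hb Hc Hd. unfold flux_eigenvalue. rewrite Ha, Hb, Hc, Hd.
split.
- intros ([x y] & Hv & H1 & H2). cbn in H1, H2.
  assert (E1 : ((a - l) * (d - l) - b * c) * x = 0).
  { replace (_ * x) with ((d - l) * (a * x + b * y - l * x) - b * (c * x + d * y - l * y)) by ring.
    rewrite H1, H2. ring. }
  assert (E2 : ((a - l) * (d - l) - b * c) * y = 0).
  { replace (_ * y) with ((a - l) * (c * x + d * y - l * y) - c * (a * x + b * y - l * x)) by ring.
    rewrite H1, H2. ring. }
  destruct (Rmult_integral _ _ E1) as [K|Kx]; [exact K|].
  destruct (Rmult_integral _ _ E2) as [K|Ky]; [exact K|].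
  exfalso. apply Hv. congruence.
- intros Hdet.
  destruct (Req_dec (a - l) 0) as [Ka|Ka];
    [destruct (Req_dec b 0) as [Kb|Kb];
      [destruct (Req_dec c 0) as [Kc|Kc]|]|].
  + exists (1, 0); cbn. split; [intros K; injection K; lra|]. lra.
  + exists (d - l, - c); cbn. split; [intros K; injection K; lra|]. split; [|lra]. nra.
  + exists (b, l - a); cbn. split; [intros K; injection K; lra|]. split; [lra|]. nra.
  + exists (b, l - a); cbn. split; [intros K; injection K; lra|]. split; [lra|]. nra.
Qed.

Lemma frac_derivatives (mu : phase -> R) (U : state) :
  (forall p, 0 < mu p) -> mobilities mu U <> 0 ->
  let q p := sat p U / mu p in
  let T := mobilities mu U in
  let Tw := 2 * (q water - q gas) in
  let To := 2 * (q oil - q gas) in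
  d_w (frac mu water) U = 2 * q water / T - sat water U * q water * Tw / T ^ 2 /\
  d_o (frac mu water) U = - (sat water U * q water * To / T ^ 2) /\
  d_w (frac mu oil) U = - (sat oil U * q oil * Tw / T ^ 2) /\
  d_o (frac mu oil) U = 2 * q oil / T - sat oil U * q oil * To / T ^ 2.
Proof.
intros Hmu HT. cbv zeta.
assert (Pw := Hmu water). assert (Po := Hmu oil). assert (Pg := Hmu gas).
unfold d_w, d_o.
destruct U as [x y]. unfold frac, mobilities, mobility in *. cbn [fst snd sat] in *.
repeat split; apply is_derive_unique; (auto_derive; [exact HT|]);
  set (T := _ + _ + _) in HT |- *.
all: clearbody T; field; lra.
Qed.

(** With [p] the common ratio of saturation to viscosity of the two equal
    phases, [q] the ratio of the phase [g] and [T] the total mobility, the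
    eigenvalues are [2 * p / T] and [2 * p * q / T ^ 2].  If [g] is water or
    oil, the Jacobian is triangular, as [T] is stationary in the other
    coordinate; if [g] is gas, it is a scalar matrix minus a matrix of rank
    at most one. *)
Lemma flux_eigenvalue_line (mu : phase -> R) (g : phase) (U : state) (l : R) :
  (forall p, 0 < mu p) -> on_invariant_line mu g U ->
  flux_eigenvalue mu U l <->
  l = lam_a (nu mu g) (eff g U) \/ l = lam_b (nu mu g) (eff g U).
Proof.
intros Hmu HU.
assert (HT := mobilities_pos mu U Hmu).
assert (P1 := Hmu (other1 g)). assert (P2 := Hmu (other2 g)). assert (P3 := Hmu g).
destruct (frac_derivatives mu U Hmu ltac:(lra)) as (Da & Db & Dc & Dd).
rewrite (flux_eigenvalue_charpoly mu U l _ _ _ _ Da Db Dc Dd).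
clear Da Db Dc Dd.
set (m := mu (other1 g) + mu (other2 g)).
assert (Hm : 0 < m) by (unfold m; lra).
set (s := eff g U).
set (p := s / m). set (q := (1 - s) / mu g).
destruct (frac_line mu g U Hmu HU) as (S1 & S2 & _).
fold m s in S1, S2.
assert (S3 : sat g U = 1 - s) by (unfold s, eff; destruct g; simpl; ring).
assert (Q1 : sat (other1 g) U = mu (other1 g) * p)
  by (rewrite S1; unfold p; field; lra).
assert (Q2 : sat (other2 g) U = mu (other2 g) * p)
  by (rewrite S2; unfold p; field; lra).
assert (Q3 : sat g U = mu g * q) by (rewrite S3; unfold q; field; lra).
assert (Hsum : m * p + mu g * q = 1) by (unfold p, q; field; lra).
set (T := mobilities mu U) in *.
assert (HTE : T = m * p ^ 2 + mu g * q ^ 2).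
{ transitivity (mobility mu (other1 g) U + mobility mu (other2 g) U +
    mobility mu g U); [unfold T, mobilities; destruct g; simpl; ring|].
  unfold mobility. rewrite Q1, Q2, Q3. unfold m. field. lra. }
assert (HE : E (nu mu g) s = m * T).
{ rewrite HTE. unfold E, nu, p, q. fold m. field. lra. }
assert (Ha : lam_a (nu mu g) s = 2 * p / T).
{ unfold lam_a. rewrite HE. unfold p. field. lra. }
assert (Hb : lam_b (nu mu g) s = 2 * p * q / T ^ 2).
{ unfold lam_b. rewrite HE. unfold p, q, nu. fold m. field. lra. }
assert (R1 : sat (other1 g) U / mu (other1 g) = p) by (rewrite Q1; field; lra).
assert (R2 : sat (other2 g) U / mu (other2 g) = p) by (rewrite Q2; field; lra).
assert (R3 : sat g U / mu g = q) by (rewrite Q3; field; lra).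
(* Both formulas come from the saturations adding up to 1; they absorb the
   viscosities, which no longer appear below. *)
assert (HTp : T = p + sat g U * (q - p)).
{ rewrite HTE, Q3. replace p with (p * (m * p + mu g * q)) at 2
    by (rewrite Hsum; ring). ring. }
assert (HTq : T = q + (sat (other1 g) U + sat (other2 g) U) * (p - q)).
{ rewrite HTE, Q1, Q2. fold m. replace q with (q * (m * p + mu g * q)) at 2
    by (rewrite Hsum; ring). unfold m. ring. }
rewrite Ha, Hb. clearbody p q T. clear - HT HTp HTq R1 R2 R3.
set (D := _ - _ * _).
assert (HD : D = (l - 2 * p / T) * (l - 2 * p * q / T ^ 2)).
{ unfold D; clear D.
  destruct g; cbn [other1 other2] in *; rewrite R1, R2, R3; clear R1 R2 R3.
  - set (x := sat water U) in *. set (y := sat oil U) in *. clearbody x y.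
    replace (2 * q / T - x * q * (2 * (q - p)) / T ^ 2)
      with (2 * p * q / T ^ 2)
      by (field_simplify_eq; [rewrite HTp; ring | lra]).
    field. lra.
  - set (x := sat water U) in *. set (y := sat oil U) in *. clearbody x y.
    replace (2 * q / T - y * q * (2 * (q - p)) / T ^ 2)
      with (2 * p * q / T ^ 2)
      by (field_simplify_eq; [rewrite HTp; ring | lra]).
    field. lra.
  - set (x := sat water U) in *. set (y := sat oil U) in *. clearbody x y.
    replace (2 * p * q / T ^ 2)
      with (2 * p / T - (x + y) * p * (2 * (p - q)) / T ^ 2)
      by (field_simplify_eq; [rewrite HTq; ring | lra]).
    field. lra. }
rewrite HD. clearbody D. split.
- intros K. destruct (Rmult_integral _ _ K); [left | right]; lra.
- intros [-> | ->]; ring.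
Qed.

Lemma lambda_s_line (mu : phase -> R) (g : phase) (U : state) :
  (forall p, 0 < mu p) -> on_invariant_line mu g U ->
  lambda_s mu U = Rmin (lam_a (nu mu g) (eff g U)) (lam_b (nu mu g) (eff g U)).
Proof.
intros Hmu HU. unfold lambda_s.
rewrite (is_glb_Rbar_unique _
  (Finite (Rmin (lam_a (nu mu g) (eff g U)) (lam_b (nu mu g) (eff g U)))));
  [reflexivity|].
split.
- intros l Hl. apply (flux_eigenvalue_line mu g U l Hmu HU) in Hl.
  destruct Hl as [-> | ->]; [apply Rmin_l | apply Rmin_r].
- intros b Hb. apply Hb. apply (flux_eigenvalue_line mu g U _ Hmu HU).
  unfold Rmin. destruct Rle_dec; auto.
Qed.

Lemma lambda_f_line (mu : phase -> R) (g : phase) (U : state) :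
  (forall p, 0 < mu p) -> on_invariant_line mu g U ->
  lambda_f mu U = Rmax (lam_a (nu mu g) (eff g U)) (lam_b (nu mu g) (eff g U)).
Proof.
intros Hmu HU. unfold lambda_f.
rewrite (is_lub_Rbar_unique _
  (Finite (Rmax (lam_a (nu mu g) (eff g U)) (lam_b (nu mu g) (eff g U)))));
  [reflexivity|].
split.
- intros l Hl. apply (flux_eigenvalue_line mu g U l Hmu HU) in Hl.
  destruct Hl as [-> | ->]; [apply Rmax_l | apply Rmax_r].
- intros b Hb. apply Hb. apply (flux_eigenvalue_line mu g U _ Hmu HU).
  unfold Rmax. destruct Rle_dec; auto.
Qed.

(** * Undercompressive shocks *)

(** The difference of the speeds [speed n u s] and [speed n u m] contains the
    factor [m - s]; up to positive factors the cofactor is [Q], affine and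
    increasing in [s], so its sign is settled at [s = u], where it equals
    [left_gap n u m]. *)
Lemma line_profile (mu : phase -> R) (g : phase) (u m : R) :
  (forall p, 0 < mu p) -> 0 <= u < m -> m <= 1 ->
  0 < left_gap (nu mu g) u m ->
  viscous_profile mu (line_state mu g u) (line_state mu g m)
    (speed (nu mu g) u m).
Proof.
intros Hmu Hu Hm HR.
assert (Hn : 0 < nu mu g).
{ assert (P1 := Hmu (other1 g)). assert (P2 := Hmu (other2 g)).
  apply Rdiv_lt_0_compat; [lra | apply Hmu]. }
set (n := nu mu g) in *.
assert (HE := fun s => E_pos n s Hn).
set (Q := fun s => left_gap n u m + (1 + n) * (m + u - 2 * m * u) * (s - u)).
destruct (heteroclinic u m (fun s => n * Q s / (E n u * E n s * E n m)))
  as (y & Hy & Hy' & Hy1 & Hy2); [lra | |].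
- intros s Hs. split.
  + apply (@ex_derive_continuous R_AbsRing R_NormedModule).
    unfold Q, E. auto_derive. assert (HEs := HE s).
    assert (H1 := HE u). assert (H2 := HE m).
    apply Rgt_not_eq. unfold E in *. repeat apply Rmult_lt_0_compat; assumption.
  + apply Rdiv_lt_0_compat.
    * apply Rmult_lt_0_compat; [exact Hn|]. unfold Q.
      assert (0 <= m * (1 - u) + u * (1 - m)) by nra.
      assert (0 <= (m * (1 - u) + u * (1 - m)) * ((1 + n) * (s - u)))
        by (apply Rmult_le_pos; nra).
      nra.
    * repeat apply Rmult_lt_0_compat; apply HE.
- assert (Hode : forall s, s ^ 2 / E n s - u ^ 2 / E n u - speed n u m * (s - u) =
    (s - u) * (m - s) * (n * Q s / (E n u * E n s * E n m))).
  { intros s. assert (H0 := HE s). assert (H1 := HE u). assert (H2 := HE m).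
    unfold speed, Q, left_gap. field_simplify_eq; [|lra]. unfold E. ring. }
  assert (Hlim : forall (x : Rbar) (l a b : R), is_lim y x l ->
    is_lim (fun t => a + b * y t) x (a + b * l)).
  { intros x l a b Hl. apply is_lim_plus with (Finite a) (Finite (b * l));
      [apply is_lim_const | | reflexivity].
    apply (is_lim_scal_l y b x l Hl). }
  assert (Haff : forall a b t dy, is_derive y t dy ->
    is_derive (fun t => a + b * y t) t (b * dy)).
  { intros a b t dy Hdy. evar_last.
    - apply (is_derive_plus (fun _ => a) (fun t => b * y t));
        [apply is_derive_const | apply (is_derive_scal y), Hdy].
    - apply plus_zero_l. }
  exists (fun t => line_state mu g (y t)).
  split; [|split; [|split; [|split; [|split; [|split]]]]].
  + intros t. specialize (Hy t).
    apply (line_state_on_line mu g (y t) Hmu); lra.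
  + intros t. rewrite !flux_line_state by (try assumption; specialize (Hy t); lra).
    fold n. cbn [line_state fst snd]. evar_last; [apply Haff, Hy'|].
    rewrite <- Hode. ring.
  + intros t. rewrite !flux_line_state by (try assumption; specialize (Hy t); lra).
    fold n. cbn [line_state fst snd]. evar_last; [apply Haff, Hy'|].
    rewrite <- Hode. ring.
  + apply Hlim, Hy1.
  + apply Hlim, Hy1.
  + apply Hlim, Hy2.
  + apply Hlim, Hy2.
Qed.

Lemma undercompressive_on_line (mu : phase -> R) (g : phase) (u m : R) :
  (forall p, 0 < mu p) ->
  let n := nu mu g in
  0 <= u -> (1 + n) * u < n -> n < (1 + n) * m -> m <= 1 ->
  0 < slow_gap n u m -> 0 < left_gap n u m -> 0 < right_gap n u m ->
  undercompressive_shock mu (line_state mu g u) (line_state mu g m)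
    (speed n u m).
Proof.
intros Hmu n Hu Hus Hms Hm HS HL HR.
assert (Hn : 0 < n).
{ assert (P1 := Hmu (other1 g)). assert (P2 := Hmu (other2 g)).
  apply Rdiv_lt_0_compat; [lra | apply Hmu]. }
assert (Hum : u < m) by (apply Rmult_lt_reg_l with (1 + n); lra).
assert (LU := line_state_on_line mu g u Hmu ltac:(lra)).
assert (LM := line_state_on_line mu g m Hmu ltac:(lra)).
assert (EU := eff_line_state mu g u Hmu).
assert (EM := eff_line_state mu g m Hmu).
assert (Hprod : 0 < E n u * E n m) by (apply Rmult_lt_0_compat; apply E_pos, Hn).
assert (A1 := speed_lt_lam_b_left n u m Hn Hum HL).
assert (A2 := lam_b_lt_speed_right n u m Hn ltac:(lra) Hm ltac:(lra)).
assert (A3 : lam_a n u < speed n u m).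
{ assert (K := speed_minus_lam_a_left n u m Hn).
  assert (0 < slow_gap n u m / (E n u * E n m)) by (apply Rdiv_lt_0_compat; lra).
  lra. }
assert (A4 : speed n u m < lam_a n m).
{ assert (K := lam_a_minus_speed_right n u m Hn).
  assert (0 < right_gap n u m / (E n u * E n m)) by (apply Rdiv_lt_0_compat; lra).
  lra. }
split; [apply LU|]. split; [apply LM|]. split; [|split; [|split; [|split]]].
- intros K. rewrite K in EU. lra.
- assert (K := rh_speed_rankine_hugoniot mu g _ _ Hmu LU LM).
  unfold rh_speed in K. rewrite EU, EM in K. exact K.
- rewrite (lambda_s_line mu g _ Hmu LU), (lambda_f_line mu g _ Hmu LU), EU.
  fold n. rewrite Rmin_left, Rmax_right by lra. lra.
- rewrite (lambda_s_line mu g _ Hmu LM), (lambda_f_line mu g _ Hmu LM), EM.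
  fold n. rewrite Rmin_right, Rmax_left by lra. lra.
- apply line_profile; try assumption. lra.
Qed.

Theorem theorem5p1 (mu : phase -> R) (Hmu : forall p, 0 < mu p)
  (g : phase) (Hnu : 1 < nu mu g <= 8)
  (M : state) (HM : on_invariant_line mu g M)
  (HsM : eff g (umbilic mu) < eff g M <= 1) :
  exists Us Uf : state,
    (on_invariant_line mu g Us /\ 0 <= eff g Us < eff g (umbilic mu)) /\
    (on_invariant_line mu g Uf /\ 0 <= eff g Uf < eff g (umbilic mu)) /\
    eff g Uf < eff g Us /\
    (forall U : state, on_invariant_line mu g U ->
       eff g Uf < eff g U < eff g Us ->
       undercompressive_shock mu U M (rh_speed mu g U M)) /\
    rh_speed mu g Us M = lambda_s mu Us /\
    (eff g (umbilic mu) < eff g M <= s_Y mu g ->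
       rh_speed mu g Uf M = lambda_f mu M) /\
    (s_Y mu g < eff g M <= 1 ->
       rh_speed mu g Uf M = lambda_f mu Uf).
Proof.
assert (Hrh : forall U, rh_speed mu g U M = speed (nu mu g) (eff g U) (eff g M))
  by reflexivity.
assert (Hum := eff_umbilic mu g Hmu).
set (n := nu mu g) in *. set (m := eff g M) in *.
set (s0 := eff g (umbilic mu)) in *.
assert (Hn : 0 < n) by lra.
assert (Hs0 : forall x, (1 + n) * x < n -> x < s0)
  by (intros x Hx; apply Rmult_lt_reg_l with (1 + n); lra).
assert (Hms : n < (1 + n) * m).
{ assert ((1 + n) * s0 < (1 + n) * m) by (apply Rmult_lt_compat_l; lra). lra. }
assert (Hh := umbilic_gt_half n m ltac:(lra) Hms).
destruct (slow_root_range n m) as [S0 S1]; try lra.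
destruct (fast_threshold n m) as (F & F0 & F1 & F2 & F3 & F4 & F5 & F6); try lra.
set (S := slow_root n m) in *.
assert (S2 : S < 1) by (apply Rmult_lt_reg_l with (1 + n); lra).
assert (LS := line_state_on_line mu g S Hmu ltac:(lra)).
assert (LF := line_state_on_line mu g F Hmu ltac:(lra)).
exists (line_state mu g S), (line_state mu g F).
rewrite !eff_line_state by assumption.
split; [split; [exact LS | split; [lra | apply Hs0, S1]]|].
split; [split; [exact LF | split; [lra | apply Hs0, F1]]|].
split; [exact F2|]. split; [|split; [|split]].
- intros U HU HUr. rewrite Hrh.
  rewrite (on_line_line_state mu g M Hmu HM). fold m.
  rewrite (on_line_line_state mu g U Hmu HU), eff_line_state by assumption.
  set (u := eff g U) in *.
  assert (Hu1 : (1 + n) * u < n).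
  { apply Rlt_trans with ((1 + n) * S); [|exact S1].
    apply Rmult_lt_compat_l; lra. }
  apply undercompressive_on_line; fold n; try assumption; try lra.
  + rewrite slow_gap_factor by lra. fold S.
    apply Rmult_lt_0_compat; [lra | apply slow_root_den; lra].
  + assert (K := left_gap_increasing n F u m Hn ltac:(lra) ltac:(lra) ltac:(lra)).
    lra.
  + apply F4; lra.
- rewrite Hrh, (lambda_s_line mu g _ Hmu LS), eff_line_state by assumption.
  fold n. rewrite Rmin_left by (apply lam_order_left; lra).
  assert (K := speed_minus_lam_a_left n S m Hn).
  rewrite slow_gap_factor in K by lra. fold S in K.
  unfold Rdiv in K. rewrite Rminus_diag, !Rmult_0_l in K. lra.
- intros HmY. rewrite Hrh, (lambda_f_line mu g _ Hmu HM), eff_line_state by assumption.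
  fold n m. rewrite Rmax_left by (apply lam_order_right; lra).
  assert (K := lam_a_minus_speed_right n F m Hn).
  rewrite F5 in K by apply HmY.
  unfold Rdiv in K. rewrite Rmult_0_l in K. lra.
- intros HmY. rewrite Hrh, (lambda_f_line mu g _ Hmu LF), eff_line_state by assumption.
  fold n m. rewrite Rmax_right by (apply lam_order_left; lra).
  assert (K := lam_b_minus_speed n F m Hn).
  rewrite F6 in K by apply HmY.
  unfold Rdiv in K. rewrite Rmult_0_r, Rmult_0_l in K. lra.
Qed.
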